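(* Let $\Sigma=\operatorname{cov}(\mathbf e_1(d))$ be the $d\times d$ covariance matrix of the errors and let $\boldsymbol\Delta_d,\mathbf p_d\in\mathbb R^d$ be nonzero vectors. If $\Sigma$ is invertible, then $$\mathcal E_1(\boldsymbol\Delta_d,\mathbf p_d)=\|\Sigma^{-1/2}\boldsymbol\Delta_d\|\,\cos\big(\alpha_{\Sigma^{-1/2}\boldsymbol\Delta_d,\;\Sigma^{1/2}\mathbf p_d}\big).$$
   Context: $\mathcal E_1(\boldsymbol\Delta_d,\mathbf p_d)=|\langle\boldsymbol\Delta_d,\mathbf p_d\rangle|/\tau(\mathbf p_d)$ with $\tau^2(\mathbf p_d)=\mathbf p_d^T\Sigma\,\mathbf p_d$ (this is the high dimensional efficiency of change point tests based on projecting the data onto $\mathbf p_d$ when the change is $\boldsymbol\Delta_d$). $\alpha_{\mathbf u,\mathbf v}\in[0,\pi/2]$ denotes the smallest angle between the lines spanned by $\mathbf u$ and $\mathbf v$, so $\cos\alpha_{\mathbf u,\mathbf v}=|\langle\mathbf u,\mathbf v\rangle|/(\|\mathbf u\|\|\mathbf v\|)$. $\Sigma^{1/2}$ is the symmetric positive definite square root of $\Sigma$, $\Sigma^{-1/2}$ its inverse; $\|\cdot\|$ is the Euclidean norm. *)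

(* Defs.v *)
From HB Require Import structures.
From mathcomp Require Import all_boot all_order all_algebra.
From mathcomp Require Import all_classical all_reals all_analysis.

Set Implicit Arguments.
Unset Strict Implicit.
Unset Printing Implicit Defensive.

Import Order.TTheory GRing.Theory Num.Theory.

Local Open Scope classical_set_scope.
Local Open Scope ring_scope.

Section Euclidean.
Context {R : realType} {d : nat}.
Implicit Types u v : 'cV[R]_d.

Definition dotv u v : R := \sum_(i < d) u i 0 * v i 0.

(* The library norm on matrices is the sup norm, hence this definition. *)
Definition enorm u : R := Num.sqrt (dotv u u).

Definition vangle u v : R := acos (dotv u v / (enorm u * enorm v)).

(* Two vectors spanning the lines of u and v make either the angle of u and v
   or the supplementary angle of u and - v. *)
Definition line_angle u v : R := Num.min (vangle u v) (vangle u (- v)).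

End Euclidean.

Section SquareRoot.
Context {R : realType} {d : nat}.
Implicit Types A S : 'M[R]_d.

Definition posdefmx A : Prop :=
  forall x : 'cV[R]_d, x != 0 -> 0 < dotv x (A *m x).

Definition is_mxsqrt A S : Prop :=
  [/\ S \is symmetricmx, posdefmx S & S *m S = A].

(* Unique when it exists, i.e. for symmetric positive definite A; otherwise
   the value is 0. *)
Definition mxsqrt A : 'M[R]_d := xget 0 [set S | is_mxsqrt A S].

End SquareRoot.

Section Covariance.
Context {dT : measure_display} {T : measurableType dT} {R : realType}
  (P : probability T R) {d : nat}.

Definition covmx (e : 'I_d -> {RV P >-> R}) : 'M[R]_d :=
  \matrix_(i, j) fine (covariance P (e i) (e j)).

End Covariance.

Section Efficiency.
Context {R : realType} {d : nat} (Sigma : 'M[R]_d).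

Definition tau (p : 'cV[R]_d) : R := Num.sqrt ((p^T *m Sigma *m p) 0 0).

Definition efficiency (Delta p : 'cV[R]_d) : R := `|dotv Delta p| / tau p.

End Efficiency.

(* Main.v *)
(* With S the symmetric positive definite square root of Sigma, the inner product
   <Delta, p> equals <S^-1 Delta, S p> and tau p equals |S p|, so the identity is
   the formula for the cosine of the angle between two lines. The square root
   exists because a covariance matrix is positive semidefinite: it is r(Sigma)^2
   for a real polynomial r interpolating the fourth root at the eigenvalues of
   Sigma. *)
Require Import Defs.
From HB Require Import structures.
From mathcomp Require Import all_boot all_order all_algebra.
From mathcomp Require Import all_classical all_reals all_analysis.
From mathcomp Require Import complex ring lra.

Set Implicit Arguments.
Unset Strict Implicit.
Unset Printing Implicit Defensive.

Import Order.TTheory GRing.Theory Num.Theory.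

Local Open Scope ring_scope.

(** Newton interpolation: a new node is met by adding a multiple of the polynomial [q] that vanishes
    at the earlier nodes but not at the new one. A repeated node needs no correction. *)
Lemma interpolation_exists (F : fieldType) (g : F -> F) (s : seq F) :
  exists r : {poly F}, {in s, forall x, r.[x] = g x}.
Proof.
elim: s => [|x s [r rg]]; first by exists 0.
have [xs|xs] := boolP (x \in s).
  by exists r => y; rewrite inE => /orP[/eqP->|]; exact: rg.
pose q := \prod_(z <- s) ('X - z%:P).
have qx : q.[x] != 0 by rewrite -rootE root_prod_XsubC.
exists (r + ((g x - r.[x]) / q.[x]) *: q) => y.
rewrite inE hornerD hornerZ => /orP[/eqP->|ys].
  by rewrite divfK// addrC subrK.
have /eqP-> : root q y by rewrite root_prod_XsubC.
by rewrite mulr0 addr0 rg.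
Qed.

(** * Euclidean geometry and the angle between two lines *)

Section Dotv.
Context {R : realType} {d : nat}.
Implicit Types u v : 'cV[R]_d.

Lemma dotvE u v : dotv u v = (u^T *m v) 0 0.
Proof. by rewrite mxE; apply: eq_bigr => i _; rewrite mxE. Qed.

Lemma dotvC u v : dotv u v = dotv v u.
Proof. by apply: eq_bigr => i _; rewrite mulrC. Qed.

Lemma dotv_mull (A : 'M[R]_d) u v : dotv (A *m u) v = dotv u (A^T *m v).
Proof. by rewrite !dotvE trmx_mul mulmxA. Qed.

Lemma dotvN u v : dotv u (- v) = - dotv u v.
Proof. by rewrite !dotvE mulmxN mxE. Qed.

Lemma dotv_ge0 u : 0 <= dotv u u.
Proof. by apply: sumr_ge0 => i _; rewrite -expr2 sqr_ge0. Qed.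

Lemma dotv_eq0 u : (dotv u u == 0) = (u == 0).
Proof.
apply/eqP/eqP => [|->]; last by rewrite dotvE mulmx0 mxE.
move/psumr_eq0P => u0; apply/matrixP => i j; rewrite ord1 mxE.
have /eqP := u0 (fun i _ => sqr_ge0 (u i 0)) i isT.
by rewrite mulf_eq0 orbb => /eqP.
Qed.

Lemma dotv_gt0 u : (0 < dotv u u) = (u != 0).
Proof. by rewrite lt_def dotv_ge0 andbT dotv_eq0. Qed.

Lemma enorm_gt0 u : (0 < enorm u) = (u != 0).
Proof. by rewrite sqrtr_gt0 dotv_gt0. Qed.

Lemma enormN u : enorm (- u) = enorm u.
Proof. by rewrite /enorm dotvN dotvC dotvN opprK. Qed.

Lemma sqr_enorm u : enorm u ^+ 2 = dotv u u.
Proof. by rewrite sqr_sqrtr// dotv_ge0. Qed.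

Lemma dotv_Cauchy_Schwarz u v : `|dotv u v| <= enorm u * enorm v.
Proof.
have [->|u0] := eqVneq u 0.
  by rewrite dotvC dotvE mulmx0 mxE normr0 mulr_ge0 ?sqrtr_ge0.
have uu : 0 < dotv u u by rewrite dotv_gt0.
rewrite -(@ler_pXn2r _ 2) ?nnegrE ?mulr_ge0 ?sqrtr_ge0//.
rewrite real_normK ?num_real// exprMn !sqr_enorm.
(* This vector is [dotv u u] times the component of [v] orthogonal to [u]; its squared norm is
   [a * (a * c - b * b)]. *)
have := dotv_ge0 (dotv u u *: v - dotv u v *: u).
have dotvBZ a b w : dotv w (a *: v - b *: u) = a * dotv w v - b * dotv w u.
  by rewrite !dotvE mulmxBr -!scalemxAr !mxE.
rewrite dotvBZ !(dotvC (_ - _)) !dotvBZ (dotvC v u).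
set a := dotv u u in uu *; set b := dotv u v; set c := dotv v v => h.
rewrite -subr_ge0 -(pmulr_rge0 _ uu).
by rewrite (_ : a * _ = a * (a * c - b * b) - b * (a * b - b * a)); [|ring].
Qed.

(** Since [acos] is decreasing, the smaller of [acos t] and [acos (- t)] is the one taken at [|t|];
    Cauchy-Schwarz keeps [t] in its domain. *)
Lemma cos_line_angle u v : u != 0 -> v != 0 ->
  cos (line_angle u v) = `|dotv u v| / (enorm u * enorm v).
Proof.
move=> u0 v0; have n0 : 0 < enorm u * enorm v by rewrite mulr_gt0 ?enorm_gt0.
rewrite /line_angle /vangle dotvN enormN mulNr.
set t := dotv u v / _.
have -> : `|dotv u v| / (enorm u * enorm v) = `|t|.
  by rewrite normrM normfV (gtr0_norm n0).
have t1 : -1 <= t <= 1.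
  by rewrite -ler_norml normrM normfV (gtr0_norm n0) ler_pdivrMr// mul1r
    dotv_Cauchy_Schwarz.
have Nt1 : -1 <= - t <= 1 by rewrite -ler_norml normrN ler_norml.
have acos_le (x y : R) : -1 <= x <= 1 -> -1 <= y <= 1 -> acos x <= acos y -> y <= x.
  move=> x1 y1; rewrite !leNgt; apply: contra => xy.
  by rewrite -ltr_cos ?in_itv/= ?acos_ge0 ?acos_lepi// !acosK ?in_itv.
have [le_acos|/ltW le_acos] := leP (acos t) (acos (- t)).
  rewrite acosK ?in_itv//= ger0_norm//.
  by have := acos_le _ _ t1 Nt1 le_acos; lra.
rewrite acosK ?in_itv//= ler0_norm//.
by have := acos_le _ _ Nt1 t1 le_acos; lra.
Qed.

End Dotv.

(** * Existence of the matrix square root *)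

Lemma symmetricmxP (F : fieldType) n (A : 'M[F]_n) :
  reflect (A^T = A) (A \is symmetricmx).
Proof.
by apply: (iffP (is_hermitianmxP _ _ _)); rewrite expr0 scale1r map_mx_id//.
Qed.

Lemma trmx_horner_mx (F : comNzRingType) n (A : 'M[F]_n.+1) (q : {poly F}) :
  (horner_mx A q)^T = horner_mx A^T q.
Proof.
elim/poly_ind: q => [|q c IHq]; first by rewrite !rmorph0 trmx0.
rewrite !rmorphD !rmorphM /= !horner_mx_X !horner_mx_C linearD /= tr_scalar_mx.
rewrite -[_ * A]/(_ *m A) trmx_mul IHq; congr (_ + _).
(* Transposition reverses products, so [A^T] has to commute with a polynomial in [A^T]. *)
exact: (@comm_mx_horner _ _ A^T A^T q erefl).
Qed.

Section SquareRootExistence.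
Context {R : realType}.

(** By symmetry a left eigenvector transposes to a right one, where the quadratic form is [a] times
    a positive squared norm. *)
Lemma psd_eigenvalue_ge0 d (A : 'M[R]_d) (a : R) :
  A \is symmetricmx -> (forall x, 0 <= dotv x (A *m x)) ->
  eigenvalue A a -> 0 <= a.
Proof.
move=> /symmetricmxP Asym A0.
case/eigenvalueP => v vA v0.
have vv : 0 < dotv v^T v^T by rewrite dotv_gt0 trmx_eq0.
have := A0 v^T; rewrite -{1}Asym -trmx_mul vA linearZ/= dotvE -scalemxAr mxE.
by rewrite -dotvE pmulr_lge0.
Qed.

(* Here s lists the eigenvalues of A, which is diagonalizable over R[i]; it is
   enough to control real polynomials because s is real. *)
Lemma psd_horner_mx_eq0 n (A : 'M[R]_n.+1) :
  A \is symmetricmx -> (forall x, 0 <= dotv x (A *m x)) ->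
  exists2 s : seq R, all (>= 0) s &
    forall q : {poly R}, {in s, forall x, q.[x] = 0} -> horner_mx A q = 0.
Proof.
move=> Asym A0; pose B := map_mx (real_complex R) A.
have Breal : B \is a mxOver Num.real.
  by apply/mxOverP => i j; rewrite mxE complex_real.
have Bsym : B \is symmetricmx.
  by apply/symmetricmxP; rewrite map_trmx (symmetricmxP _ Asym).
(* Over [R[i]], the real symmetric [B] is Hermitian, hence normal: it is conjugate to [diag_mx D] by
   [P], with [D] real. *)
have Bherm := realsym_hermsym Bsym Breal.
have /orthomx_spectralP BE := hermitian_normalmx Bherm.
have Dreal := hermitian_spectral_diag_real Bherm.
move: BE Dreal; set P := spectralmx B; set D := spectral_diag B => BE Dreal.
have Pu : P \is a GRing.unit by exact: spectral_unit.
have DE i : D 0 i = real_complex R (complex.Re (D 0 i)).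
  by have /mxOverP/(_ 0 i)/complex_realP[x ->] := Dreal.
exists [seq complex.Re (D 0 i) | i <- enum 'I_n.+1].
  apply/allP => _ /mapP[i _ ->] /=.
  apply: (psd_eigenvalue_ge0 Asym A0).
  rewrite -(eigenvalue_map (real_complex R)) /= -DE -/B.
  (* The rows of [P] are left eigenvectors of [B], nonzero because [P] is invertible. *)
  apply/eigenvalueP; exists (row i P); last first.
    apply/eqP => /(congr1 (fun w => w *m invmx P)).
    rewrite -row_mul mulmxV// mul0mx => /rowP/(_ i).
    by rewrite !mxE eqxx => /eqP; rewrite oner_eq0.
  rewrite [in LHS]BE -row_mul !mulmxA mulmxV// mul1mx.
  by rewrite row_mul row_diag_mx -scalemxAl -rowE.
(* Over [R[i]], [q] of the matrix is conjugate to the diagonal matrix of the values of [q] at the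
   eigenvalues, all zero. *)
move=> q q0; apply: (map_mx_inj (f := real_complex R)).
rewrite map_horner_mx -/B BE horner_mx_uconjC// horner_mx_diag.
rewrite (_ : map_mx _ _ = 0) ?linear0 ?mulmx0 ?mul0mx ?map_mx0//.
apply/rowP => i; rewrite !mxE DE horner_map q0 ?rmorph0//.
by apply/mapP; exists i; rewrite ?mem_enum.
Qed.

Lemma mxsqrt_exists d (A : 'M[R]_d) :
  A \is symmetricmx -> (forall x, 0 <= dotv x (A *m x)) -> A \in unitmx ->
  exists S, is_mxsqrt A S.
Proof.
case: d A => [|n] A Asym A0 Au.
  (* Dimension 0 is set apart because [horner_mx] takes matrices of size [n.+1]; there [A] is its
     own root. *)
  exists A; split => //; last by apply/matrixP => -[].
  by move=> x; rewrite (flatmx0 x) eqxx.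
have [s s0 sA] := psd_horner_mx_eq0 Asym A0.
have [r rE] := interpolation_exists (fun x => Num.sqrt (Num.sqrt x)) s.
(* The square root is itself taken as a square, of the symmetric matrix T with
   T ^+ 4 = A, which makes its positivity immediate. *)
pose T := horner_mx A r.
have T4 : T ^+ 4 = A.
  (* The polynomial [r ^+ 4 - 'X] vanishes on [s], whose elements are nonnegative. *)
  apply/eqP; rewrite -subr_eq0 -rmorphXn /= -[X in _ - X]horner_mx_X -rmorphB.
  apply/eqP/sA => x xs; have x0 := allP s0 _ xs.
  rewrite hornerD hornerN hornerX horner_exp rE// (exprM _ 2 2).
  by rewrite !sqr_sqrtr ?sqrtr_ge0// subrr.
have Tsym : T^T = T by rewrite trmx_horner_mx (symmetricmxP _ Asym).
have Tu : T \in unitmx by rewrite -(@unitrX_pos _ T 4)// T4.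
exists (T *m T); split.
- by apply/symmetricmxP; rewrite trmx_mul Tsym.
- move=> x x0; rewrite -mulmxA -{1}Tsym -dotv_mull dotv_gt0.
  by apply: contraNneq x0 => Tx; rewrite -[x](mulKmx Tu) Tx mulmx0.
- by rewrite -[RHS]T4 !exprS expr0 mulr1 -mulmxA.
Qed.

End SquareRootExistence.

(** * Positive semidefiniteness of covariance matrices *)

Section CovariancePsd.
Context {dT : measure_display} {T : measurableType dT} {R : realType}
  (P : probability T R) {d : nat}.

Lemma covmx_sym (e : 'I_d -> {RV P >-> R}) : covmx e \is symmetricmx.
Proof.
by apply/symmetricmxP/matrixP => i j; rewrite !mxE covarianceC.
Qed.

Lemma covariance_suml (I : Type) (s : seq I) (a : I -> R) (X : I -> T -> R)
    (Y : T -> R) :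
  (forall i, X i \in Lfun P 2%:E) -> Y \in Lfun P 2%:E ->
  fine (covariance P (\sum_(i <- s) a i *: X i) Y) =
  \sum_(i <- s) a i * fine (covariance P (X i) Y).
Proof.
move=> X2 Y2; have Pfin : P setT \is a fin_num by exact: fin_num_measure.
have Z2 i : a i *: X i \in Lfun P 2%:E by rewrite rpredZ// lee1n.
have Y1 := Lfun_subset12 Pfin Y2.
have fin Z : Z \in Lfun P 2%:E -> covariance P Z Y \is a fin_num.
  by move=> ?; rewrite covariance_fin_num ?Lfun2_mul_Lfun1// Lfun_subset12.
elim: s => [|i s IHs]; first by rewrite !big_nil covariance_cst_l.
have S2 : \sum_(i <- s) a i *: X i \in Lfun P 2%:E by rewrite rpred_sum ?lee1n.
rewrite !big_cons covarianceDl// fineD ?fin// IHs; congr (_ + _).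
rewrite (_ : a i *: X i = a i \o* X i); last first.
  by apply/funext => t; rewrite /= mulrC.
by rewrite covarianceZl ?Lfun2_mul_Lfun1 ?(Lfun_subset12 Pfin)// fineM ?fin.
Qed.

(** By bilinearity, the quadratic form at [x] is the variance of the combination [Y] of the errors
    with coefficients [x]. *)
Lemma covmx_psd (e : 'I_d -> {RV P >-> R}) (x : 'cV[R]_d) :
  (forall i, (e i : T -> R) \in Lfun P 2%:E) ->
  0 <= dotv x (covmx e *m x).
Proof.
move=> e2; pose Y : T -> R := \sum_(i < d) x i 0 *: (e i : T -> R).
have Y2 : Y \in Lfun P 2%:E.
  by rewrite rpred_sum ?lee1n// => ? j _; rewrite rpredZ.
suff -> : dotv x (covmx e *m x) = fine (covariance P Y Y).
  by rewrite fine_ge0// variance_ge0.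
rewrite {1}/Y covariance_suml//; apply: eq_bigr => i _; congr (_ * _).
rewrite covarianceC covariance_suml// mxE; apply: eq_bigr => j _.
by rewrite mxE mulrC covarianceC.
Qed.

End CovariancePsd.

Theorem proposition2p6 (dT : measure_display) (T : measurableType dT)
    (R : realType) (P : probability T R) (d : nat)
    (e : 'I_d -> {RV P >-> R})
    (he : forall i : 'I_d, (e i : T -> R) \in Lfun P 2%:E)
    (Sigma : 'M[R]_d) (hSigma : Sigma = covmx e)
    (Delta p : 'cV[R]_d) (hDelta : Delta != 0) (hp : p != 0)
    (hinv : Sigma \in unitmx) :
  efficiency Sigma Delta p =
    enorm (invmx (mxsqrt Sigma) *m Delta) *
    cos (line_angle (invmx (mxsqrt Sigma) *m Delta) (mxsqrt Sigma *m p)).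
Proof.
have [S0 S0P] : exists S, is_mxsqrt Sigma S.
  by apply: mxsqrt_exists => //; rewrite hSigma;
    [exact: covmx_sym | move=> x; exact: covmx_psd].
(* Existence rules out the default value 0 in [mxsqrt]. *)
have [] : is_mxsqrt Sigma (mxsqrt Sigma) by exact: (xgetI _ S0P).
move: (mxsqrt Sigma) => S /symmetricmxP Ssym _ SS.
have Su : S \in unitmx by move: hinv; rewrite -SS unitmx_mul andbb.
have mulS_neq0 (M : 'M[R]_d) x : M \in unitmx -> x != 0 -> M *m x != 0 :> 'cV_d.
  by move=> Mu; apply: contraNneq => Mx; rewrite -[x](mulKmx Mu) Mx mulmx0.
have u0 : invmx S *m Delta != 0 by rewrite mulS_neq0// unitmx_inv.
have v0 : S *m p != 0 by rewrite mulS_neq0.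
rewrite cos_line_angle// dotv_mull trmx_inv Ssym mulKmx//.
rewrite /efficiency /tau (_ : Num.sqrt _ = enorm (S *m p)); last first.
  by rewrite /enorm dotvE trmx_mul Ssym -SS !mulmxA.
(* The factor [enorm (invmx S *m Delta)] cancels, being nonzero because [Delta] is. *)
by rewrite invfM mulrCA [X in _ = _ * X]mulrA divff ?mul1r// gt_eqF ?enorm_gt0.
Qed.
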